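(* Let $\Omega\subset\mathbb{R}^2$ be contained in the interior of $[0,1]^2$, and let $n_\Lambda\to\infty$ with the ratio $\gamma=n_\Lambda/n_R\in(0,1]$ held constant. Let $N_{\delta\Omega}=N_{\delta\Omega}(n_\Lambda)$ be the number of grid points of $\Omega$ neighbouring the boundary. Let $c(P_\Omega)$ and $h(P_\Omega)$ denote the number of distinct connected components and the number of holes of the set of grid points in $\Omega$, and assume that the limit $$\lim_{n_\Lambda\to\infty}\big(h(P_\Omega)-c(P_\Omega)\big)=C$$ exists with $C<\infty$. Then for the discrete space- and band-limiting operator $T_\Omega B_\Lambda T_\Omega$ and every fixed $\epsilon>0$, the size of the plunge region satisfies, as $n_\Lambda\to\infty$, $$\eta(\epsilon,N_R)=O\big(N_{\delta\Omega}\log n_R\big).$$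
   Context: For positive integers $n_\Lambda\le n_R$ (numbers of frequencies, respectively time-domain grid points, per dimension), let $N_R=n_R^2$, $N_\Lambda=n_\Lambda^2$ and $$I_R=\{0,1,\dots,n_R-1\}^2,\qquad I_\Omega=\{k\in I_R:\ k/n_R\in\Omega\},\qquad P_\Omega=\{k/n_R:\ k\in I_\Omega\}.$$ The sets $I_\Omega$ and $P_\Omega$ are identified by scaling. The operator $T_\Omega B_\Lambda T_\Omega$ acts on arrays indexed by $I_R$; it is the matrix with entries $$(T_\Omega B_\Lambda T_\Omega)_{k,l}=B(k-l)\quad\text{for } k,l\in I_\Omega,\qquad (T_\Omega B_\Lambda T_\Omega)_{k,l}=0\ \text{ otherwise},$$ where for $k=(k_1,k_2)$ $$B(k)=b(k_1)\,b(k_2),\qquad b(m)=\frac{\sin(\pi n_\Lambda m/n_R)}{n_R\sin(\pi m/n_R)}\ \ (m\neq0),\qquad b(0)=\frac{n_\Lambda}{n_R}.$$ (Here $T_\Omega$ sets all values outside $I_\Omega$ to zero and $B_\Lambda$ removes all discrete frequencies outside a block of $n_\Lambda\times n_\Lambda$ consecutive frequencies.) This is a positive semidefinite Hermitian matrix with eigenvalues $\lambda_k\in[0,1]$. The numbers $\sigma_k=\sqrt{\lambda_k}$ (counted with multiplicity) are, apart from zeros, the singular values of the collocation matrix $A$ with entries $\frac{1}{\sqrt{N_R}}e^{2\pi i\, x\cdot l}$, whose rows are indexed by $x\in P_\Omega$ and whose columns are indexed by the $N_\Lambda$ integer frequencies $l$ in a block of $n_\Lambda\times n_\Lambda$ consecutive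 frequencies. The plunge region size is $$\eta(\epsilon,N_R)=\#\{k:\ \epsilon<\sigma_k<1-\epsilon\}.$$ The boundary points are $$P_{\delta\Omega}=\{k\in I_\Omega:\ \exists\, l\in\mathbb{Z}^2,\ \|l\|_\infty=1,\ k+l\notin I_\Omega\},\qquad N_{\delta\Omega}=|P_{\delta\Omega}|.$$ Components of $I_\Omega\subset\mathbb{Z}^2$ are taken with respect to $8$-connectivity (points adjacent when at $\ell_\infty$-distance $1$). A hole is a connected component of the complement $\mathbb{Z}^2\setminus I_\Omega$ that is entirely surrounded by $I_\Omega$, i.e. a finite component of the complement, where the complement is given $4$-connectivity. All of $n_R$, $N_R$, $I_R$, $I_\Omega$, $P_\Omega$, $N_{\delta\Omega}$ depend on $n_\Lambda$ through $n_R=n_\Lambda/\gamma$, with $n_\Lambda$ running through values for which $n_R$ is an integer. The set $\Omega$ is fixed, and the constant in $O(\cdot)$ may depend on $\Omega$, $\gamma$ and $\epsilon$ but not on $n_\Lambda$. *)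

(* Defs.v *)
From HB Require Import structures.
From mathcomp Require Import all_boot all_order all_algebra.
From mathcomp Require Import finmap.
From mathcomp Require Import all_classical all_reals all_analysis.
From mathcomp Require Import spectral.
From mathcomp Require Import complex.

Set Implicit Arguments.
Unset Strict Implicit.
Unset Printing Implicit Defensive.

Import Order.TTheory GRing.Theory Num.Theory.
Import numFieldNormedType.Exports.

Local Open Scope classical_set_scope.
Local Open Scope ring_scope.

Definition norm_inf (k : int * int) : int := Num.max `|k.1| `|k.2|.

Definition norm_one (k : int * int) : int := `|k.1| + `|k.2|.

Definition adj8 : rel (int * int) := fun k l => norm_inf (k - l) == 1.

Definition adj4 : rel (int * int) := fun k l => norm_one (k - l) == 1.

Definition linked (e : rel (int * int)) (S : set (int * int))
    (x y : int * int) : Prop :=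
  exists p : seq (int * int),
    [/\ path e x p, last x p = y & [set` x :: p] `<=` S].

Definition components (e : rel (int * int)) (S : set (int * int)) :
    set (set (int * int)) :=
  [set [set y | linked e S x y] | x in S].

(* The sets counted with fset_set below are finite as soon as S is, so that
   the default value fset0 of fset_set on infinite sets plays no role. *)
Definition num_components (S : set (int * int)) : nat :=
  #|` fset_set (components adj8 S)|.

Definition holes (S : set (int * int)) : set (set (int * int)) :=
  [set H | components adj4 (~` S) H /\ finite_set H].

Definition num_holes (S : set (int * int)) : nat := #|` fset_set (holes S)|.

Section Grid.
Context {R : realType}.
Implicit Types (Omega : set (R * R)) (nL nR : nat).

Definition I_Omega Omega nR : set (int * int) :=
  [set k | [/\ 0 <= k.1 < nR%:Z, 0 <= k.2 < nR%:Z &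
               Omega (k.1%:~R / nR%:R, k.2%:~R / nR%:R)]].

Definition boundary_points Omega nR : set (int * int) :=
  [set k | I_Omega Omega nR k /\
     exists l : int * int, norm_inf l = 1 /\ ~ I_Omega Omega nR (k + l)].

Definition N_boundary Omega nR : nat :=
  #|` fset_set (boundary_points Omega nR)|.

Definition b_kernel nL nR (m : int) : R :=
  if m == 0 then nL%:R / nR%:R
  else sin (pi * nL%:R * m%:~R / nR%:R) / (nR%:R * sin (pi * m%:~R / nR%:R)).

Definition B_kernel nL nR (k : int * int) : R :=
  b_kernel nL nR k.1 * b_kernel nL nR k.2.

Definition grid_index nR : finType := ('I_nR * 'I_nR)%type.

(* Rows and columns are indexed by I_R through the enumeration of
   'I_nR * 'I_nR. *)
Definition grid_point nR (i : 'I_#|grid_index nR|) : int * int :=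
  let k := enum_val i in (Posz k.1, Posz k.2).

Definition TBT Omega nL nR : 'M[R]_#|grid_index nR| :=
  \matrix_(i, j)
    if (grid_point i \in I_Omega Omega nR) && (grid_point j \in I_Omega Omega nR)
    then B_kernel nL nR (grid_point i - grid_point j) else 0.

(* spectral_diag lists the eigenvalues, with multiplicity, of a normal matrix
   over the closed field R[i]; those of the real symmetric matrix TBT are
   real, so that the real part loses nothing. *)
Definition lambda Omega nL nR (k : 'I_#|grid_index nR|) : R :=
  complex.Re (spectral_diag (map_mx (real_complex R) (TBT Omega nL nR)) 0 k).

Definition sigma Omega nL nR (k : 'I_#|grid_index nR|) : R :=
  Num.sqrt (lambda Omega nL k).

Definition plunge_size Omega nL nR (eps : R) : nat :=
  #|[set k : 'I_#|grid_index nR| | eps < sigma Omega nL k < 1 - eps]%SET|.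

(* As nL tends to infinity with nL / nR = gamma held constant, nR = nL / gamma
   has to be an integer: limits in nL are taken along
   within (admissible gamma) \oo, on which n_R gamma nL = nL / gamma. *)
Definition admissible (gamma : R) : set nat :=
  [set nL | (0 < nL)%N /\ nL%:R / gamma \is a Num.nat].

Definition n_R (gamma : R) nL : nat := Num.truncn (nL%:R / gamma).

End Grid.

(* Main.v *)
Require Import Defs.
From HB Require Import structures.
From mathcomp Require Import all_boot all_order all_algebra.
From mathcomp Require Import finmap.
From mathcomp Require Import all_classical all_reals all_analysis.
From mathcomp Require Import spectral complex.
From mathcomp Require Import ring lra zify.
Import Order.TTheory GRing.Theory Num.Theory.
Import numFieldNormedType.Exports.
Local Open Scope classical_set_scope.
Local Open Scope ring_scope.

(** The proof measures the plunge region by a trace. Write A = T B T. As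
    the compression of an orthogonal projection B (the matrix [band]) by a
    coordinate projection T (the matrix [mask]), A has its eigenvalues in the
    unit interval ([lambda_itv]); each one with eps < sigma < 1 - eps contributes
    at least eps^3 to the sum of lambda (1 - lambda), and the others contribute
    a nonnegative amount ([plunge_le]). So it suffices to bound tr A - tr A^2 by a
    multiple of N (1 + ln n), where N is the number of boundary points.

    This trace is the sum over grid points k of Omega of
    B(0) - sum_l B(k - l)^2, with l running through the grid points of Omega
    ([sum_lambda_defect]). By Parseval B(0) is the sum of B(v)^2 over a window of
    n x n displacements centred at the origin ([dirichlet2_sq_window]), so the
    trace is at most the sum over this window of B(v)^2 times the number of
    points k of Omega for which k + v is not a grid point of Omega
    ([sum_defect_le_escape]). A displacement v decomposes into |v1| + |v2| unit
    steps, on one of which k leaves Omega, passing through a boundary point; so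
    that number is at most (|v1| + |v2|) N ([escape_lattice]).

    What remains is the first moment of B(v)^2 on the window. The kernel factors
    over the coordinates, and |b(m)| <= 1/|m| for |m| <= n/2 ([dirichlet_decay]),
    so the moment is bounded by a harmonic sum, which is of order ln n
    ([dirichlet2_moment]). *)

(** * The Dirichlet kernel *)

Section Dirichlet.
Variable R : realType.
Implicit Types (n nL : nat) (m x y : int).

(** Each term 2 sin h cos z is the difference sin (z + h) - sin (z - h), and
    consecutive terms cancel. *)
Lemma sum_cos_telescope n (a h : R) :
  2 * sin h * \sum_(l < n) cos (a + l%:R * (2 * h)) =
  sin (a + n%:R * (2 * h) - h) - sin (a - h).
Proof.
have step (z : R) : 2 * sin h * cos z = sin (z + h) - sin (z - h).
  by rewrite sinD sinB; ring.
elim: n => [|n IH]; first by rewrite big_ord0 mul0r addr0 mulr0 subrr.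
rewrite big_ord_recr /= mulrDr IH step.
have -> : a + n.+1%:R * (2 * h) - h = a + n%:R * (2 * h) + h.
  by rewrite -(@natr1 _ n); ring.
ring.
Qed.

Lemma sinM_nat_pi (n : nat) : sin (n%:R * pi : R) = 0.
Proof.
elim: n => [|n IH]; first by rewrite mul0r sin0.
by rewrite -natr1 mulrDl mul1r sinD sinpi IH mulr0 mul0r addr0.
Qed.

Lemma sin_rat_pi_neq0 n m : (0 < `|m| < n)%N -> sin (pi * m%:~R / n%:R : R) != 0.
Proof.
move=> /andP[m0 mn].
have n0 : (0 : R) < n%:R by rewrite ltr0n (leq_ltn_trans _ mn).
have pos (d : nat) : (0 < d < n)%N -> sin (pi * d%:R / n%:R : R) != 0.
  move=> /andP[d0 dn]; rewrite gt_eqF// sin_gt0_pi//; apply/andP; split.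
    by rewrite divr_gt0// mulr_gt0 ?pi_gt0 ?ltr0n.
  by rewrite ltr_pdivrMr// ltr_pM2l ?pi_gt0// ltr_nat.
case: m m0 mn => d /=; first by move=> d0 dn; rewrite -pmulrn pos ?d0.
move=> _ dn; rewrite NegzE mulrNz mulrN mulNr sinN oppr_eq0.
by rewrite -pmulrn pos.
Qed.

(** Orthogonality of discrete frequencies, for an arbitrary phase [a]: the
    arguments of the two boundary terms of the telescoping sum differ by a
    multiple of 2 pi. *)
Lemma sum_cos_over_period n m (a : R) : (0 < `|m| < n)%N ->
  \sum_(l < n) cos (a + l%:R * (2 * (pi * m%:~R / n%:R))) = 0.
Proof.
move=> mn; have sn0 := sin_rat_pi_neq0 _ _ mn.
have n0 : (n%:R : R) != 0.
  by rewrite pnatr_eq0 -lt0n; case/andP: mn => _; exact: leq_ltn_trans.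
have := sum_cos_telescope n a (pi * m%:~R / n%:R).
have -> : sin (a + n%:R * (2 * (pi * m%:~R / n%:R)) - pi * m%:~R / n%:R) =
          sin (a - pi * m%:~R / n%:R).
  have -> : a + n%:R * (2 * (pi * m%:~R / n%:R)) - pi * m%:~R / n%:R =
            (a - pi * m%:~R / n%:R) + 2 * (m%:~R * pi) by field.
  have sm : sin (m%:~R * pi : R) = 0.
    case: (m) => d; first by rewrite -pmulrn sinM_nat_pi.
    by rewrite NegzE mulrNz mulNr sinN -pmulrn sinM_nat_pi oppr0.
  rewrite sinD mulr_natl sin_mulr2n cos_mulr2n cos2sin2 sm expr0n /=; ring.
rewrite subrr => /eqP; rewrite !mulf_eq0 (negbTE sn0) pnatr_eq0 /=.
by move/eqP.
Qed.

(** The block of [nL] consecutive frequencies, shifted so that it is symmetric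
    about 0; the shift is by a half-integer when [nL] is even. Symmetry makes
    the kernel real. *)
Definition freq nL n (j : 'I_nL) : R := pi * (2 * j%:R + 1 - nL%:R) / n%:R.

Arguments freq {nL} n j.

Lemma freq_rev nL n (j : 'I_nL) : freq n (rev_ord j) = - freq n j.
Proof.
rewrite /freq /= natrB// -(@natr1 _ j); ring.
Qed.

(** [b_kernel] as a sum over the frequency block. Unlike the quotient of sines,
    this form has no exceptional value at the nonzero multiples of [n]. *)
Definition dirichlet nL n m : R := n%:R^-1 * \sum_(j < nL) cos (m%:~R * freq n j).

Lemma sum_sin_freq nL n (z : R) : \sum_(j < nL) sin (z * freq n j) = 0.
Proof.
have : \sum_(j < nL) sin (z * freq n j) = - \sum_(j < nL) sin (z * freq n j).
  rewrite [LHS](reindex_inj rev_ord_inj) -sumrN; apply: eq_bigr => j _.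
  by rewrite freq_rev mulrN sinN.
move: (\sum_(j < nL) _) => S; lra.
Qed.

(** The sines sum to zero by symmetry of the frequencies, so the product of the
    two cosine sums is the double sum of cosines of sums. *)
Lemma dirichletM nL n x y : dirichlet nL n x * dirichlet nL n y =
  n%:R^-1 ^+ 2 * \sum_(i < nL) \sum_(j < nL)
                    cos (x%:~R * freq n i + y%:~R * freq n j).
Proof.
rewrite /dirichlet mulrACA -expr2; congr (_ * _).
rewrite mulr_suml; apply: eq_bigr => i _.
under [RHS]eq_bigr do rewrite cosD.
by rewrite sumrB -!mulr_sumr sum_sin_freq mulr0 subr0.
Qed.

(** Convolution with the kernel is idempotent because distinct frequencies of
    the block, differing by less than [n], are orthogonal over any [n]
    consecutive integers, whatever the starting point [M]. *)
Lemma dirichlet_idem nL n (M : int) x y : (nL <= n)%N ->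
  \sum_(l < n) dirichlet nL n (x - (M + l%:Z)) * dirichlet nL n (M + l%:Z - y) =
  dirichlet nL n (x - y).
Proof.
move=> nLn; have [->|n0] := posnP n.
  by rewrite big_ord0 /dirichlet invr0 mul0r.
have n0R : (n%:R : R) != 0 by rewrite pnatr_eq0 -lt0n.
under eq_bigr do rewrite dirichletM.
rewrite -mulr_sumr exchange_big /=.
under eq_bigr do rewrite exchange_big /=.
rewrite expr2 -mulrA; congr (_ * _); rewrite mulr_sumr; apply: eq_bigr => i _.
rewrite (bigD1 i)//= [X in _ * (_ + X)]big1 ?addr0.
  rewrite (eq_bigr (fun=> cos ((x - y)%:~R * freq n i))).
    by rewrite sumr_const card_ord -(mulr_natl (cos _)) mulKf.
  by move=> l _; congr cos; rewrite !intrB; ring.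
move=> j ij.
pose c := (x - M)%:~R * freq n i + (M - y)%:~R * freq n j.
rewrite -[RHS](sum_cos_over_period n (j%:Z - i%:Z) c).
  apply: eq_bigr => l _; congr cos.
  rewrite /c /freq !intrB !intrD -!pmulrn; field.
  by [].
move: (ltn_ord i) (ltn_ord j) ij; rewrite -(inj_eq val_inj) /=; lia.
Qed.

Lemma b_kernelE nL n m : (`|m| < n)%N -> b_kernel nL n m = dirichlet nL n m.
Proof.
move=> mn; have n0 : (n%:R : R) != 0.
  by rewrite pnatr_eq0 -lt0n (leq_ltn_trans _ mn).
rewrite /b_kernel /dirichlet; case: eqP => [->|/eqP m0].
  under eq_bigr do rewrite mul0r cos0.
  by rewrite sumr_const card_ord mulrC.
have sn0 : sin (pi * m%:~R / n%:R : R) != 0.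
  by apply: sin_rat_pi_neq0; rewrite mn andbT absz_gt0.
set h := pi * m%:~R / n%:R in sn0 *.
have := sum_cos_telescope nL ((1 - nL%:R) * h) h.
have -> : (1 - nL%:R) * h + nL%:R * (2 * h) - h = nL%:R * h by ring.
have -> : (1 - nL%:R) * h - h = - (nL%:R * h) by ring.
have -> : pi * nL%:R * m%:~R / n%:R = nL%:R * h by rewrite /h; ring.
rewrite sinN opprK => e.
rewrite (eq_bigr (fun l : 'I__ => cos ((1 - nL%:R) * h + l%:R * (2 * h)))); last first.
  by move=> j _; congr cos; rewrite /freq /h; ring.
move: e; move: (\sum_(i < nL) _) => S e; apply: (@mulfI _ (2 * n%:R * sin h)).
  by rewrite !mulf_eq0 !negb_or n0 sn0 pnatr_eq0.
have -> : 2 * n%:R * sin h * (n%:R^-1 * S) = 2 * sin h * S by field.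
by rewrite e; field; rewrite sn0 n0.
Qed.

Lemma dirichletN nL n m : dirichlet nL n (- m) = dirichlet nL n m.
Proof.
rewrite /dirichlet; congr (_ * _); apply: eq_bigr => j _.
by rewrite mulrNz mulNr cosN.
Qed.

Lemma dirichlet0 nL n : dirichlet nL n 0 = nL%:R / n%:R.
Proof.
rewrite /dirichlet; under eq_bigr do rewrite mul0r cos0.
by rewrite sumr_const card_ord mulrC.
Qed.

(** By duplication sin x = 2 cos (x/2) sin (x/2), and the mean value theorem
    gives sin (x/2) = (x/2) cos c with c <= x/2 <= pi/4, so that both cosines
    are at least the square root of 1/2. *)
Lemma sin_ge_half (x : R) : 0 <= x <= pi / 2 -> x / 2 <= sin x.
Proof.
move=> /andP[x0 x1].
have cont : {within `[0, x / 2]%classic, continuous (@sin R)}.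
  by apply: continuous_subspaceT; exact: continuous_sin.
have x20 : 0 <= x / 2 by lra.
have [c] := @MVT_segment R sin cos 0 (x / 2) x20 (fun _ _ => is_derive_sin _) cont.
rewrite in_itv /= sin0 !subr0 => /andP[c0 cx] sE.
have cosle (z : R) : 0 <= z <= x / 2 -> 2^-1 <= cos z ^+ 2.
  move=> /andP[z0 zx].
  have : 0 <= cos (z *+ 2).
    apply: cos_ge0_pihalf; have := pi_ge0 R.
    by rewrite -mulr_natl => ?; apply/andP; split; lra.
  rewrite cos_mulr2n -mulr_natl => ?; lra.
have cge0 (z : R) : 0 <= z <= x / 2 -> 0 <= cos z.
  move=> /andP[z0 zx]; apply: cos_ge0_pihalf; have := pi_ge0 R => ?.
  by apply/andP; split; lra.
have -> : sin x = 2 * (cos (x / 2) * cos c) * (x / 2).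
  have -> : sin x = sin ((x / 2) *+ 2) by congr sin; rewrite mulr2n; lra.
  by rewrite sin_mulr2n sE mulr2n; ring.
suff : 2^-1 <= cos (x / 2) * cos c by move=> ?; nra.
have b1 : 0 <= x / 2 <= x / 2 by rewrite x20 lexx.
have b2 : 0 <= c <= x / 2 by rewrite c0 cx.
have := cosle _ b1; have := cosle _ b2; have := cge0 _ b1; have := cge0 _ b2.
set p := cos c; set q := cos (x / 2) => p0 q0 pp qq.
have : 2^-1 * 2^-1 <= q ^+ 2 * p ^+ 2 by apply: ler_pM; lra.
rewrite -exprMn; have := mulr_ge0 q0 p0; move: (q * p) => t t0 tt; nra.
Qed.

(** The bound |b(m)| <= 1/|m|, valid up to half a period: the numerator of
    [b_kernel] is at most 1 and n |sin (pi m / n)| >= |m|. It is written so as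
    to say nothing of the size of the kernel at 0. *)
Lemma dirichlet_decay nL n m : (`|m| * 2 <= n)%N ->
  dirichlet nL n m ^+ 2 * `|m|%N%:R <= `|m|%N%:R^-1.
Proof.
move=> mn; have [->|m0] := eqVneq m 0; first by rewrite /= mulr0 invr0.
set d := `|m|%N; have d0 : (0 < d)%N by rewrite absz_gt0.
have n0 : (0 : R) < n%:R by rewrite ltr0n; lia.
have d0R : (0 : R) < d%:R by rewrite ltr0n.
have -> : dirichlet nL n m ^+ 2 = dirichlet nL n d%:Z ^+ 2.
  by rewrite /d; case: (m) => k //; rewrite NegzE abszN dirichletN.
have dn : (d < n)%N by lia.
rewrite -b_kernelE// /b_kernel; case: eqP => [|_]; first by lia.
have le1 : d%:R / n%:R <= sin (pi * d%:Z%:~R / n%:R : R).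
  have -> : d%:R / n%:R = (2 * d%:R / n%:R) / 2 :> R by field; rewrite gt_eqF.
  have dpi : 2 * d%:R / n%:R <= pi * d%:Z%:~R / n%:R :> R.
    by rewrite -pmulrn ler_pM2r ?invr_gt0// ler_pM2r// pi_ge2.
  apply: le_trans (_ : pi * d%:Z%:~R / n%:R / 2 <= _); first by lra.
  apply: sin_ge_half; apply/andP; split.
    by rewrite divr_ge0 ?mulr_ge0 ?pi_ge0 ?ltW// -pmulrn ltW.
  rewrite -pmulrn ler_pdivrMr// -mulrA ler_pM2l ?pi_gt0//.
  have : (d * 2)%:R <= n%:R :> R by rewrite ler_nat.
  by rewrite natrM => ?; lra.
have s2 := @sin_max R (pi * nL%:R * d%:Z%:~R / n%:R).
move: le1 s2; move: (sin _) => s; move: (sin _) => t le1 s2.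
have ds : d%:R <= n%:R * s by rewrite mulrC -ler_pdivrMr.
have s2' : t ^+ 2 <= 1 by rewrite -real_normK ?num_real// expr_le1.
rewrite expr_div_n mulrAC ler_pdivrMr; last by rewrite exprn_gt0//; lra.
rewrite ler_pdivlMl//.
have : d%:R * d%:R <= (n%:R * s) ^+ 2 by rewrite expr2; apply: ler_pM; lra.
have := sqr_ge0 t; nra.
Qed.

(** One more term 1/(n + 1) is at most the increment ln (n + 1) - ln n, because
    ln (1 - x) <= - x. The term for [d = 0] vanishes since [0^-1 = 0]. *)
Lemma harmonic_le_ln n : (0 < n)%N ->
  \sum_(d < n.+1) d%:R^-1 <= 1 + ln (n%:R : R).
Proof.
elim: n => // -[_ _|n IH _].
  by rewrite big_ord_recr big_ord1 /= invr0 add0r invr1 ln1 addr0.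
rewrite big_ord_recr /=; have := IH isT.
set p : R := n.+1%:R => le.
have p0 : 0 < p by rewrite ltr0n.
have p1 : (p + 1)^-1 < 1 by rewrite invf_lt1; lra.
have lnp : ln p = ln (p + 1) + ln (1 - (p + 1)^-1).
  rewrite -lnM ?posrE ?subr_gt0 ?addr_gt0//.
  by congr ln; field; rewrite gt_eqF// addr_gt0.
have : ln (1 - (p + 1)^-1) <= - (p + 1)^-1 by apply: le_ln1Dx; rewrite ltrN2.
by rewrite -!(@natr1 _ n.+1) -/p; lra.
Qed.

End Dirichlet.

Arguments dirichlet {R} nL n m.
Arguments freq {R nL} n j.

(** * Spectra of real symmetric matrices *)

Section Spectrum.
Variables (R : realType) (N : nat).
Local Open Scope sesquilinear_scope.
Local Notation toC := (map_mx (real_complex R)).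
Implicit Types (A X : 'M[R]_N) (u : 'rV[R[i]]_N).

Definition eigval A (k : 'I_N) : R := complex.Re (spectral_diag (toC A) 0 k).

Lemma conj_real_mx m n (A : 'M[R]_(m, n)) : (toC A) ^t* = toC A^T.
Proof.
by apply/matrixP => i j; rewrite !mxE; apply/eqP; rewrite eq_complex /= oppr0 !eqxx.
Qed.

Lemma toC_hermitian A : A^T = A -> toC A \is hermsymmx.
Proof.
move=> sA; apply/is_hermitianmxP.
by rewrite expr0 scale1r conj_real_mx sA.
Qed.

Lemma spectral_diag_eigval A : A^T = A ->
  spectral_diag (toC A) = toC (\row_k eigval A k).
Proof.
move=> /toC_hermitian/hermitian_spectral_diag_real/mxOverP D_real.
apply/matrixP => i j; rewrite ord1 !mxE; apply/eqP; rewrite eq_complex /= eqxx.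
by have /complex_realP[x ->] := D_real 0 j; rewrite /= eqxx.
Qed.

Lemma spectral_decomposition A : A^T = A ->
  toC A = (spectralmx (toC A)) ^t* *m toC (diag_mx (\row_k eigval A k)) *m
          spectralmx (toC A).
Proof.
move=> sA; have /hermitian_normalmx/orthomx_spectralP := toC_hermitian _ sA.
by rewrite invmx_unitary ?spectral_unitarymx// spectral_diag_eigval// map_diag_mx.
Qed.

Lemma sum_eigval A : A^T = A -> \sum_k eigval A k = \tr A.
Proof.
move=> sA; have := congr1 (@mxtrace _ _) (spectral_decomposition _ sA).
rewrite mxtrace_mulC mulmxA (unitarymxP (spectral_unitarymx _)) mul1mx.
rewrite !trace_map_mx mxtrace_diag => /complexI ->.
by apply: eq_bigr => k _; rewrite mxE.
Qed.

Lemma sum_eigval_sq A : A^T = A -> \sum_k eigval A k ^+ 2 = \tr (A *m A).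
Proof.
move=> sA; have sD := spectral_decomposition _ sA.
have := congr1 (fun M : 'M[R[i]]_N => \tr (M *m M)) sD; rewrite /= -map_mxM.
set U := spectralmx _; set D := diag_mx _.
have UU : U *m U ^t* = 1%:M by apply/unitarymxP/spectral_unitarymx.
rewrite !mulmxA mxtrace_mulC !mulmxA UU mul1mx -(mulmxA _ U) UU mulmx1.
rewrite -map_mxM !trace_map_mx => /complexI ->.
rewrite mulmx_diag mxtrace_diag.
by apply: eq_bigr => k _; rewrite !mxE expr2.
Qed.

(** [u] is the [k]-th row of the unitary matrix that diagonalises [A]. *)
Lemma eigval_quadratic A k : A^T = A -> exists2 u : 'rV[R[i]]_N,
  u *m u ^t* = 1%:M & u *m toC A *m u ^t* = ((eigval A k)%:C)%C%:M.
Proof.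
move=> sA; have sD := spectral_decomposition _ sA.
set U := spectralmx _ in sD; set D := diag_mx _ in sD.
have UU : U *m U ^t* = 1%:M by apply/unitarymxP/spectral_unitarymx.
pose e : 'rV[R[i]]_N := delta_mx 0 k.
have ee : e ^t* = delta_mx k 0 by rewrite trmx_delta map_delta_mx.
exists (e *m U); rewrite trmx_mul map_mxM ee.
  rewrite -mulmxA (mulmxA U) UU mul1mx mul_delta_mx.
  by apply/matrixP => i j; rewrite !ord1 !mxE.
rewrite sD -!mulmxA (mulmxA U) UU mul1mx (mulmxA U) UU mul1mx.
rewrite map_diag_mx -colE -rowE.
by apply/matrixP => i j; rewrite !ord1 !mxE eqxx !mulr1n.
Qed.

Lemma gram_ge0 m (X : 'M[R]_(N, m)) u : 0 <= (u *m toC (X *m X^T) *m u ^t*) 0 0.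
Proof.
have -> : toC (X *m X^T) = toC X *m toC X^T := map_mxM _ _ _.
rewrite -conj_real_mx.
have -> : u *m (toC X *m (toC X) ^t*) *m u ^t* = (u *m toC X) *m (u *m toC X) ^t*.
  by rewrite trmx_mul map_mxM !mulmxA.
rewrite mxE sumr_ge0// => i _; rewrite !mxE; exact: mul_conjC_ge0.
Qed.


Lemma eigval_ge0 A k m (X : 'M[R]_(N, m)) : A = X *m X^T -> 0 <= eigval A k.
Proof.
move=> AE; have [|u _ uA] := eigval_quadratic A k.
  by rewrite AE trmx_mul trmxK.
have := gram_ge0 _ X u; rewrite -AE uA mxE eqxx mulr1n.
by rewrite -(rmorph0 (real_complex R)) lecR.
Qed.

Lemma eigval_le1 A k m1 m2 (Y : 'M[R]_(N, m1)) (Z : 'M[R]_(N, m2)) :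
  1%:M - A = Y *m Y^T + Z *m Z^T -> eigval A k <= 1.
Proof.
move=> AE; have A1 : A = 1%:M - (Y *m Y^T + Z *m Z^T) by rewrite -AE opprB addrC subrK.
have [|u uu uA] := eigval_quadratic A k.
  by rewrite A1 linearB linearD /= !trmx_mul !trmxK trmx1.
have {}AE : toC (Y *m Y^T) + toC (Z *m Z^T) = 1%:M - toC A.
  by rewrite -map_mxD -AE map_mxB map_mx1.
have := addr_ge0 (gram_ge0 _ Y u) (gram_ge0 _ Z u).
have -> (M P : 'M[R[i]]_1) : M 0 0 + P 0 0 = (M + P) 0 0 by rewrite mxE.
rewrite -mulmxDl -mulmxDr AE mulmxBr mulmx1 mulmxBl uu uA !mxE eqxx !mulr1n.
by rewrite subr_ge0 -(rmorph1 (real_complex R)) lecR.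
Qed.

(** T P T = (T P)(T P)^T and 1 - T P T = (1 - T)^2 + (T (1 - P))(T (1 - P))^T,
    so both quadratic forms are nonnegative. *)
Lemma eigval_compression (T P : 'M[R]_N) k :
  T^T = T -> T *m T = T -> P^T = P -> P *m P = P ->
  0 <= eigval (T *m P *m T) k <= 1.
Proof.
move=> sT tT sP pP; apply/andP; split.
  apply: (@eigval_ge0 _ _ _ (T *m P)).
  by rewrite trmx_mul sT sP !mulmxA -(mulmxA T P P) pP.
apply: (@eigval_le1 _ _ _ _ (1%:M - T) (T *m (1%:M - P))).
have compl (Q : 'M[R]_N) : Q^T = Q -> Q *m Q = Q ->
    (1%:M - Q)^T = 1%:M - Q /\ (1%:M - Q) *m (1%:M - Q) = 1%:M - Q.
  move=> sQ QQ; rewrite linearB /= trmx1 sQ; split=> //.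
  by rewrite mulmxBl mul1mx mulmxBr mulmx1 QQ subrr subr0.
have [sT' tT'] := compl T sT tT; have [sP' pP'] := compl P sP pP.
rewrite trmx_mul sT' tT' sT sP' -!mulmxA (mulmxA (1%:M - P)) pP' !mulmxA.
by rewrite mulmxBr mulmx1 mulmxBl tT addrA subrK.
Qed.

End Spectrum.

(** * Translates leaving a finite set *)

Lemma ler_sum_uniq_sub (R : numDomainType) (T : eqType) (s t : seq T)
    (F : T -> R) : uniq s -> uniq t -> {subset s <= t} -> (forall x, 0 <= F x) ->
  \sum_(x <- s) F x <= \sum_(x <- t) F x.
Proof.
move=> us ut st F0; have ps : perm_eq s [seq x <- t | x \in s].
  apply: uniq_perm; rewrite ?filter_uniq// => x; rewrite mem_filter.
  by case: (boolP (x \in s)) => // /st ->.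
by rewrite (perm_big _ ps) big_filter [leRHS](bigID (mem s))/= lerDl sumr_ge0.
Qed.

Section Escape.
Variables (V : zmodType) (R : realType).
Implicit Types (S W : seq V) (g : V -> R) (v w k : V).

Definition escape S v : nat := count (fun k => k + v \notin S) S.

Lemma escape0 S : escape S 0 = 0%N.
Proof.
by apply/eqP; rewrite eqn0Ngt -has_count; apply/hasPn => k kS; rewrite addr0 kS.
Qed.

(** A point that leaves [S] under [v + w] either leaves it under [v], or is moved
    by [v] to a point of [S] that leaves it under [w]. *)
Lemma escapeD S v w : uniq S -> (escape S (v + w) <= escape S v + escape S w)%N.
Proof.
move=> uS; pose P k := k + v \notin S; pose Q k := k + (v + w) \notin S.
have : (count Q S <= count P S + count (predI Q (predC P)) S)%N.
  rewrite -count_predUI; apply: leq_trans (leq_addr _ _).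
  by apply: sub_count => k /=; case: (P k); rewrite ?orbT // => ->.
move=> /leq_trans; apply; rewrite leq_add2l.
rewrite -size_filter -(size_map (fun k => k + v)) -[leqRHS]size_filter.
apply: uniq_leq_size; first by rewrite map_inj_uniq ?filter_uniq//; exact: addIr.
move=> l /mapP[k]; rewrite !mem_filter /= /P negbK => /andP[/andP[Qk Pk] kS ->].
by rewrite Pk -addrA andbT; exact: Qk.
Qed.

Lemma escapeMn S v j : uniq S -> (escape S (v *+ j) <= j * escape S v)%N.
Proof.
move=> uS; elim: j => [|j IH]; first by rewrite mulr0n escape0.
by rewrite mulrS mulSn (leq_trans (escapeD _ _ _ uS))// leq_add2l.
Qed.

(** For fixed [k], the translates [k + v] that lie in [S] contribute to the sum
    over [W] no more than the whole sum over [S]; what is left is the mass of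
    the [v] that move [k] out of [S]. *)
Lemma sum_defect_le_escape S W g : uniq S -> uniq W -> (forall v, 0 <= g v) ->
  \sum_(k <- S) (\sum_(v <- W) g v - \sum_(l <- S) g (l - k)) <=
  \sum_(v <- W) g v * (escape S v)%:R.
Proof.
move=> uS uW g0.
have -> : \sum_(v <- W) g v * (escape S v)%:R =
    \sum_(k <- S) \sum_(v <- W | k + v \notin S) g v.
  rewrite [RHS](exchange_big_dep predT) //=; apply: eq_bigr => v _.
  by rewrite -big_filter big_const_seq count_predT size_filter iter_addr_0 mulr_natr.
apply: ler_sum => k _.
rewrite [X in X - _](bigID (fun v => k + v \notin S)) /= -addrA gerDl subr_le0.
under eq_bigl do rewrite negbK.
pose s := [seq k + v | v <- W & k + v \in S].
have -> : \sum_(v <- W | k + v \in S) g v = \sum_(l <- s) g (l - k).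
  rewrite big_map big_filter; apply: eq_bigr => v _.
  by rewrite addrAC subrr add0r.
have us : uniq s by rewrite map_inj_uniq ?filter_uniq//; exact: addrI.
have sS : {subset s <= S}.
  by move=> l /mapP[v]; rewrite mem_filter => /andP[kvS _] ->.
exact: ler_sum_uniq_sub.
Qed.

End Escape.

Arguments escape {V} S v.

(** Walk from the origin to [v] by unit steps along the axes; by subadditivity
    each step costs at most [M]. *)
Lemma escape_lattice (S : seq (int * int)) (M : nat) (v : int * int) : uniq S ->
  (forall e, norm_inf e = 1 -> (escape S e <= M)%N) ->
  (escape S v <= (`|v.1| + `|v.2|) * M)%N.
Proof.
move=> uS SM; have axis (e : int * int) (m : int) : norm_inf e = 1 ->
    (escape S (e *~ m) <= `|m| * M)%N.
  move=> e1; have e1N : norm_inf (- e) = 1 by rewrite /norm_inf /= !normrN.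
  case: m => j; rewrite ?NegzE ?mulrNz -?mulNrz -?pmulrn /=;
    by rewrite (leq_trans (escapeMn _ _ _ _ _))// leq_mul2l SM ?orbT.
have vE : v = ((1, 0) : int * int) *~ v.1 + ((0, 1) : int * int) *~ v.2.
  apply: injective_projections; rewrite /= !raddfMz /= mul0rz intz;
    by rewrite ?addr0 ?add0r.
rewrite [X in escape S X]vE (leq_trans (escapeD _ _ _ _ uS))// mulnDl.
by apply: leq_add; apply: axis.
Qed.

(** * The two-dimensional kernel on a centred window *)

Section Window.
Variable n : nat.

(** The [n] consecutive integers centred at 0. Every class modulo [n] occurs
    there at its smallest absolute value, at most [n / 2], which is what
    [dirichlet_decay] needs. *)
Definition window : seq int := [seq l%:Z - n./2%:Z | l <- iota 0 n].
Definition window2 : seq (int * int) := [seq (a, b) | a <- window, b <- window].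

Lemma window_uniq : uniq window.
Proof. by rewrite map_inj_uniq ?iota_uniq// => a b; lia. Qed.

Lemma window2_uniq : uniq window2.
Proof. by apply: allpairs_uniq window_uniq window_uniq _ => -[a b] [c d]. Qed.

Lemma big_window (R : realType) (F : int -> R) :
  \sum_(m <- window) F m = \sum_(l < n) F (l%:Z - n./2%:Z).
Proof. by rewrite big_map -{1}[n]subn0 -/(index_iota 0 n) big_mkord. Qed.

End Window.

Section PlaneKernel.
Variables (R : realType) (nL n : nat).
Hypotheses (nLn : (nL <= n)%N) (n_gt0 : (0 < n)%N).
Local Notation D := (@dirichlet R nL n).
Implicit Types (k v : int * int).

Definition dirichlet2 k : R := D k.1 * D k.2.

(** Parseval: this is the reproducing identity [dirichlet_idem] on the diagonal. *)
Lemma sum_window_sq : \sum_(m <- window n) D m ^+ 2 = nL%:R / n%:R.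
Proof.
rewrite big_window -dirichlet0 -(subrr n./2%:Z) -(dirichlet_idem _ _ _ 0)//.
apply: eq_bigr => l _; rewrite add0r expr2 -(dirichletN _ _ _ (_ - _)); congr (_ * _).
by rewrite opprB.
Qed.

(** This first moment of the squared kernel is where the logarithm comes from:
    1/m^2 times |m|, summed. *)
Lemma sum_window_sqM : \sum_(m <- window n) D m ^+ 2 * `|m|%N%:R <= 2 * (1 + ln n%:R).
Proof.
rewrite big_window.
apply: (@le_trans _ _ (\sum_(l < n) `|l%:Z - n./2%:Z|%N%:R^-1)).
  apply: ler_sum => l _; apply: dirichlet_decay.
  have := ltn_ord l; have := odd_double_half n; case: odd => /=; lia.
(* Each half of the window runs through distinct absolute values. *)
pose G d : R := d%:R^-1.
have bound s (f : nat -> nat) : uniq (map f s) -> {in s, forall l, (f l <= n)%N} ->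
    \sum_(l <- s) G (f l) <= 1 + ln n%:R.
  move=> us sn; apply: le_trans (harmonic_le_ln _ _ n_gt0).
  rewrite -(big_mkord xpredT G) /index_iota subn0 -(big_map f xpredT G).
  have sS : {subset [seq f l | l <- s] <= iota 0 n.+1}.
    by move=> d /mapP[l ls ->]; rewrite mem_iota add0n ltnS sn.
  by apply: ler_sum_uniq_sub => //; [exact: iota_uniq | move=> d; rewrite invr_ge0].
rewrite -(big_mkord xpredT (fun l => G `|l%:Z - n./2%:Z|%N)).
rewrite (@big_cat_nat _ _ _ n./2)//=; last by lia.
rewrite (_ : 2 * _ = (1 + ln n%:R) + (1 + ln n%:R)); last by ring.
apply: lerD; apply: bound => [|l]; rewrite ?mem_index_iota; try lia.
  by rewrite map_inj_in_uniq ?iota_uniq// => a b; rewrite !mem_index_iota; lia.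
by rewrite map_inj_in_uniq ?iota_uniq// => a b; rewrite !mem_index_iota; lia.
Qed.

Lemma dirichlet2_sq_window : \sum_(v <- window2 n) dirichlet2 v ^+ 2 = dirichlet2 0.
Proof.
rewrite /dirichlet2 big_allpairs dirichlet0 -sum_window_sq mulr_suml.
apply: eq_bigr => a _; rewrite mulr_sumr; apply: eq_bigr => b _.
by rewrite exprMn.
Qed.

(** The kernel is a product, so each of |v1| and |v2| gives a first moment in
    one variable times the total mass, at most 1, in the other. *)
Lemma dirichlet2_moment :
  \sum_(v <- window2 n) dirichlet2 v ^+ 2 * (`|v.1| + `|v.2|)%N%:R <= 4 * (1 + ln n%:R).
Proof.
have s1 : \sum_(m <- window n) D m ^+ 2 <= 1.
  by rewrite sum_window_sq ler_pdivrMr ?ltr0n// mul1r ler_nat.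
have s0 : 0 <= \sum_(m <- window n) D m ^+ 2 by apply: sumr_ge0 => m _; apply: sqr_ge0.
have t1 := sum_window_sqM.
have t0 : 0 <= \sum_(m <- window n) D m ^+ 2 * `|m|%N%:R.
  by apply: sumr_ge0 => m _; rewrite mulr_ge0 ?sqr_ge0.
have -> : \sum_(v <- window2 n) dirichlet2 v ^+ 2 * (`|v.1| + `|v.2|)%N%:R =
    2 * ((\sum_(m <- window n) D m ^+ 2 * `|m|%N%:R) * \sum_(m <- window n) D m ^+ 2).
  rewrite mulr_natl mulr2n {2}mulrC !mulr_suml -big_split big_allpairs /=.
  apply: eq_bigr => a _; rewrite !mulr_sumr -big_split /=; apply: eq_bigr => b _.
  by rewrite /dirichlet2 /= natrD exprMn; ring.
move: s1 s0 t1 t0; set s := \sum_(m <- _) _; set t := \sum_(m <- _) _ => ? ? ? ?.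
have : t * s <= t by rewrite ler_piMr.
lra.
Qed.

End PlaneKernel.

Arguments dirichlet2 {R} nL n k.

(** * The space- and band-limiting operator *)

Section Operator.
Variables (R : realType) (Omega : set (R * R)) (nL n : nat).
Hypotheses (nLn : (nL <= n)%N) (n_gt0 : (0 < n)%N).
Local Notation D2 := (@dirichlet2 R nL n).
Local Notation I := (I_Omega Omega n).
Local Notation index := 'I_#|grid_index n|.

Lemma grid_point_inj : injective (@grid_point n).
Proof.
move=> i j; rewrite /grid_point => -[e1 e2]; apply: enum_val_inj.
by rewrite [LHS]surjective_pairing [RHS]surjective_pairing; congr pair; apply: val_inj.
Qed.

Lemma grid_pointP (k : int * int) : I k -> exists i, @grid_point n i = k.
Proof.
case: k => [[a|a] [b|b]] [] // /andP[_ an] /andP[_ bn] _.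
exists (enum_rank (Ordinal (an : (a < n)%N), Ordinal (bn : (b < n)%N))).
by rewrite /grid_point enum_rankK.
Qed.

Definition grid_points : seq (int * int) :=
  [seq grid_point i | i <- index_enum index & grid_point i \in I].

Lemma grid_points_uniq : uniq grid_points.
Proof. by rewrite map_inj_uniq ?filter_uniq ?index_enum_uniq//; exact: grid_point_inj. Qed.

Lemma mem_grid_points k : (k \in grid_points) = (k \in I).
Proof.
rewrite /grid_points.
apply/idP/idP => [kS|kI].
  by have := @mapP _ _ _ _ _ kS; case=> i; rewrite mem_filter => /andP[iI _] ->.
move: (kI); rewrite inE => /grid_pointP[i ik]; apply/mapP; exists i => //.
by rewrite mem_filter ik kI mem_index_enum.
Qed.

Lemma big_grid_points (F : int * int -> R) :
  \sum_(k <- grid_points) F k = \sum_(i : index | grid_point i \in I) F (grid_point i).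
Proof. by rewrite big_map big_filter. Qed.

(** A point moved out by a unit step is by definition a boundary point. *)
Lemma escape_unit_le (e : int * int) : norm_inf e = 1 ->
  (escape grid_points e <= N_boundary Omega n)%N.
Proof.
move=> e1; rewrite /escape -size_filter.
have fB : finite_set (boundary_points Omega n).
  apply: (@sub_finite_set _ _ [set` grid_points]); last exact: finite_seq.
  by move=> k [kI _] /=; rewrite mem_grid_points inE.
apply: uniq_leq_size; first by rewrite filter_uniq ?grid_points_uniq.
move=> k; rewrite mem_filter !mem_grid_points => /andP[keI kI].
rewrite in_fset_set// inE; split; first by move: kI; rewrite inE.
by exists e; split=> // /mem_set; apply/negP.
Qed.

Definition band : 'M[R]_#|grid_index n| :=
  \matrix_(i, j) D2 (grid_point i - grid_point j).

Definition mask : 'M[R]_#|grid_index n| :=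
  diag_mx (\row_i (grid_point i \in I)%:R).

Lemma big_grid (F : int * int -> R) :
  \sum_(i : index) F (grid_point i) = \sum_(a < n) \sum_(b < n) F (a%:Z, b%:Z).
Proof.
rewrite (reindex (@enum_rank (grid_index n))) /=; last first.
  exact/onW_bij/enum_rank_bij.
rewrite pair_big /=; apply: eq_bigr => -[a b] _.
by rewrite /grid_point enum_rankK.
Qed.

Lemma band_sym : band^T = band.
Proof.
by apply/matrixP => i j; rewrite !mxE -opprB /dirichlet2 /= !dirichletN.
Qed.

Lemma band_idem : band *m band = band.
Proof.
apply/matrixP => i j; rewrite !mxE; under eq_bigr do rewrite !mxE.
rewrite (big_grid (fun k => D2 (grid_point i - k) * D2 (k - grid_point j))).
rewrite /dirichlet2 /= -(dirichlet_idem _ _ _ 0)//.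
rewrite -[X in _ = _ * X](dirichlet_idem _ _ _ 0)//.
rewrite mulr_suml; apply: eq_bigr => a _; rewrite mulr_sumr; apply: eq_bigr => b _.
by rewrite !add0r mulrACA.
Qed.

Lemma mask_sym : mask^T = mask.
Proof. exact: tr_diag_mx. Qed.

Lemma mask_idem : mask *m mask = mask.
Proof.
rewrite mulmx_diag; congr diag_mx; apply/matrixP => i j; rewrite !mxE.
by case: (_ \in _); rewrite ?mulr1 ?mulr0.
Qed.

Lemma TBT_entry (i j : index) : TBT Omega nL n i j =
  (grid_point i \in I)%:R * (grid_point j \in I)%:R * D2 (grid_point i - grid_point j).
Proof.
have B_D2 : B_kernel nL n (grid_point i - grid_point j) = D2 (grid_point i - grid_point j).
  have lt (a b : 'I_n) : (absz (a%:Z - b%:Z)%R < n)%N.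
    by move: (ltn_ord a) (ltn_ord b); lia.
  by rewrite /B_kernel !b_kernelE//= lt.
rewrite mxE B_D2; do 2 case: (_ \in _); by rewrite /= ?mul1r ?mul0r.
Qed.

Lemma TBT_factor : TBT Omega nL n = mask *m band *m mask.
Proof.
apply/matrixP => i j; rewrite TBT_entry mul_mx_diag mxE mul_diag_mx !mxE.
by rewrite mulrAC.
Qed.

Lemma TBT_sym : (TBT Omega nL n)^T = TBT Omega nL n.
Proof. by rewrite TBT_factor !trmx_mul mask_sym band_sym mulmxA. Qed.

Lemma lambda_itv (k : index) : 0 <= lambda Omega nL k <= 1.
Proof.
have := eigval_compression R _ mask band k mask_sym mask_idem band_sym band_idem.
by rewrite -TBT_factor.
Qed.

(** Both sides are tr A - tr A^2 for A = T B T: the sums of the eigenvalues and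
    of their squares on the left, the entries of the symmetric A on the right. *)
Lemma sum_lambda_defect :
  \sum_(k : index) lambda Omega nL k * (1 - lambda Omega nL k) =
  \sum_(k <- grid_points) (D2 0 - \sum_(l <- grid_points) D2 (l - k) ^+ 2).
Proof.
under eq_bigr do rewrite mulrBr mulr1 -expr2.
rewrite sumrB (sum_eigval _ _ _ TBT_sym) (sum_eigval_sq _ _ _ TBT_sym) /mxtrace -sumrB.
rewrite (big_grid_points (fun k => D2 0 - _)) [RHS]big_mkcond /=.
apply: eq_bigr => i _; rewrite TBT_entry subrr mxE.
case: (boolP (grid_point i \in I)) => iI; last first.
  rewrite !mul0r big1 ?subrr// => j _.
  by rewrite !TBT_entry (negbTE iI) !mul0r.
rewrite !mul1r; congr (_ - _); rewrite big_grid_points [RHS]big_mkcond /=.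
apply: eq_bigr => j _; rewrite !TBT_entry iI mul1r mulr1.
case: (_ \in _); rewrite ?mul0r// !mul1r -opprB expr2.
by rewrite {1}/dirichlet2 /= !dirichletN.
Qed.

Lemma sum_lambda_defect_le :
  \sum_(k : index) lambda Omega nL k * (1 - lambda Omega nL k) <=
  4 * (N_boundary Omega n)%:R * (1 + ln n%:R).
Proof.
have uS := grid_points_uniq.
rewrite sum_lambda_defect -dirichlet2_sq_window//.
apply: le_trans
  (sum_defect_le_escape _ _ _ _ (fun v => D2 v ^+ 2) uS (window2_uniq n) _) _.
  by move=> v; exact: sqr_ge0.
have := dirichlet2_moment R _ _ nLn n_gt0.
move=> /(ler_wpM2l (ler0n R (N_boundary Omega n))).
rewrite mulr_sumr mulrA [_%:R * 4]mulrC; apply: le_trans.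
apply: ler_sum => v _; rewrite mulrCA ler_wpM2l ?sqr_ge0// -natrM ler_nat mulnC.
by apply: escape_lattice uS _ => e; exact: escape_unit_le.
Qed.

(** On the plunge region lambda = sigma^2 > eps^2 and
    1 - lambda >= 1 - sigma > eps; elsewhere lambda (1 - lambda) >= 0 since
    lambda lies in [0, 1]. *)
Lemma plunge_le (eps : R) : 0 < eps ->
  eps ^+ 3 * (plunge_size Omega nL n eps)%:R <=
  \sum_(k : index) lambda Omega nL k * (1 - lambda Omega nL k).
Proof.
move=> e0; rewrite /plunge_size mulr_natr -sumr_const.
rewrite big_mkcond; apply: ler_sum => k _; have /andP[l0 l1] := lambda_itv k.
case: ifP => [|_]; last by rewrite mulr_ge0// subr_ge0.
rewrite inE /sigma => /andP[]; have := sqr_sqrtr l0.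
move: (Num.sqrt _) => s <- es s1.
have -> : eps ^+ 3 = eps ^+ 2 * eps by ring.
by apply: ler_pM; nra.
Qed.
End Operator.

Theorem theorem9 (R : realType) (Omega : set (R * R)) (gamma : R)
    (C : \bar R) (eps : R)
  (hOmega : Omega `<=` interior (`[0, 1] `*` `[0, 1] : set (R * R)))
  (hgamma : 0 < gamma <= 1)
  (hlim : ((num_holes (I_Omega Omega (n_R gamma nL)))%:R
           - (num_components (I_Omega Omega (n_R gamma nL)))%:R)%:E
          @[nL --> within (admissible gamma) \oo] --> C)
  (hC : (C < +oo)%E)
  (heps : 0 < eps) :
  (fun nL : nat => (plunge_size Omega nL (n_R gamma nL) eps)%:R : R)
  =O_ (within (admissible gamma) \oo)
  (fun nL : nat => (N_boundary Omega (n_R gamma nL))%:R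
                   * ln ((n_R gamma nL)%:R : R)).
Proof.
move: hgamma => /andP[g0 g1].
have ln2 : 0 < ln (2 : R) by apply: ln_gt0; lra.
(* eps^-3 comes from [plunge_le]; 1 + 1 / ln 2 absorbs the constant of
   1 + ln n, as n >= 2. *)
apply/eqO_exP; exists (4 / eps ^+ 3 * (1 + (ln 2)^-1)).
  by rewrite mulr_gt0 ?divr_gt0 ?exprn_gt0 ?addr_gt0 ?invr_gt0.
rewrite near_withinE; near=> nL => -[nL0 nat_n].
have n2 : (2 <= nL)%N by near: nL; exact: nbhs_infty_ge.
set n := n_R gamma nL.
have nE : n%:R = nL%:R / gamma by rewrite truncnK.
have nLn : (nL <= n)%N.
  by rewrite -(ler_nat R) nE ler_pdivlMr// ler_piMr.
have n_gt0 : (0 < n)%N by lia.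
have lnn : ln (2 : R) <= ln n%:R.
  by rewrite ler_ln ?posrE ?ltr0n// ler_nat; lia.
rewrite !ger0_norm ?mulr_ge0 ?ln_ge0 ?ler1n//.
have le1 : 1 + ln n%:R <= (1 + (ln 2)^-1) * ln (n%:R : R).
  have : 1 <= (ln 2)^-1 * ln (n%:R : R) by rewrite ler_pdivlMl ?mulr1.
  lra.
have plunge : eps ^+ 3 * (plunge_size Omega nL n eps)%:R <=
    4 * (N_boundary Omega n)%:R * (1 + ln n%:R).
  by apply: le_trans (sum_lambda_defect_le _ _ _ _ nLn n_gt0); apply: plunge_le.
have e3 : 0 < eps ^+ 3 by rewrite exprn_gt0.
rewrite -(ler_pM2l e3); apply: le_trans plunge _.
have -> : eps ^+ 3 *
    (4 / eps ^+ 3 * (1 + (ln 2)^-1) * ((N_boundary Omega n)%:R * ln n%:R)) =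
    4 * (N_boundary Omega n)%:R * ((1 + (ln 2)^-1) * ln n%:R).
  by field; rewrite !gt_eqF.
by rewrite ler_wpM2l ?mulr_ge0.
Unshelve. all: end_near.
Qed.
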